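(* For every integer $r\ge 2$ there exists $c=c(r)>0$ such that for infinitely many integers $n$, there exists an $n$-vertex $2$-connected graph $G$ with $s_r(G)\ge c\sqrt{n}$ and $\mathcal{D}_r(G,\mathcal{T}_n)\le 1$.
   Context: Graphs are finite and simple; ''$k$-connected'' means $k$-vertex-connected. Spanning-tree discrepancy: for a connected $n$-vertex graph $G$, an $r$-colouring $f:E(G)\to[r]$ of its edges, and a spanning tree $T$ of $G$ (which has $n-1$ edges), put $D_f(T) := r\cdot\left(\max_{1\le i\le r}|f^{-1}(i)\cap E(T)| - \frac{n-1}{r}\right)$. The $r$-colour spanning-tree discrepancy of $G$ is $\mathcal{D}_r(G,\mathcal{T}_n) := \min_{f:E(G)\to[r]}\ \max_{T} D_f(T)$, where the maximum is over all spanning trees $T$ of $G$. Balanced $r$-separation number: $s_r(G)$ is the minimum $s$ for which there is a partition $V(G)=V_1\cup\dots\cup V_r\cup S$ with $|V_1|=\dots=|V_r|$, $|S|=s$, and no edges of $G$ between $V_i$ and $V_j$ for any $1\le i<j\le r$ (the parts may be empty). *)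

(* Defs.v *)
From HB Require Import structures.
From mathcomp Require Import all_boot all_order all_algebra.
From mathcomp Require Import reals constructive_ereal.

Set Implicit Arguments.
Unset Strict Implicit.
Unset Printing Implicit Defensive.

Import Order.TTheory GRing.Theory Num.Theory.

Record sgraph := SGraph {
  vertex :> finType;
  adj : rel vertex;
  adj_sym : symmetric adj;
  adj_irr : irreflexive adj }.

Arguments adj : clear implicits.

Section Connectivity.

Variable G : sgraph.

Definition graph_connected : bool :=
  (0 < #|G|) && [forall x : G, forall y : G, connect (adj G) x y].

(* A cycle has at least three vertices, all distinct; [:: x; y] is a ucycle
   of the relation [adj G] as soon as x and y are adjacent, hence [2 < k].
   Distinctness bounds the length by #|G|. *)
Definition graph_acyclic : bool :=
  [forall k : 'I_#|G|.+1, forall p : k.-tuple G,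
     (2 < k) ==> ~~ ucycleb (adj G) p].

Definition is_tree : bool := graph_connected && graph_acyclic.

Section Induced.

Variable A : {set G}.

Definition induced_adj : rel {x : G | x \in A} :=
  fun x y => adj G (val x) (val y).

Fact induced_sym : symmetric induced_adj.
Proof. by move=> x y; apply: adj_sym. Qed.

Fact induced_irr : irreflexive induced_adj.
Proof. by move=> x; apply: adj_irr. Qed.

Definition induced : sgraph := SGraph induced_sym induced_irr.

End Induced.

End Connectivity.

Definition vertex_connected (k : nat) (G : sgraph) : bool :=
  (k < #|G|) &&
  [forall S : {set G}, (#|S| < k) ==> graph_connected (induced (~: S))].

Section Edges.

Variable G : sgraph.

Definition edge_set : {set {set G}} :=
  [set e | [exists x : G, exists y : G, adj G x y && (e == [set x; y])]].

Definition edge : finType := {e : {set G} | e \in edge_set}.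

Section SpanningSubgraph.

Variable A : {set edge}.

Definition spanning_adj : rel G :=
  fun x y => [exists e in A, val e == [set x; y]].

Fact spanning_sym : symmetric spanning_adj.
Proof. by move=> x y; rewrite /spanning_adj setUC. Qed.

Fact spanning_irr : irreflexive spanning_adj.
Proof.
move=> x; apply/negbTE/existsP => -[e /andP[_ /eqP he]].
have := valP e; rewrite he inE => /existsP[y /existsP[z /andP[yz /eqP hx]]].
have /set1P yx : y \in [set x] by rewrite -(setUid [set x]) hx set21.
have /set1P zx : z \in [set x] by rewrite -(setUid [set x]) hx set22.
by move: yz; rewrite yx zx adj_irr.
Qed.

Definition spanning_subgraph : sgraph := SGraph spanning_sym spanning_irr.

End SpanningSubgraph.

Definition spanning_trees : {set {set edge}} :=
  [set T | is_tree (spanning_subgraph T)].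

Local Open Scope ring_scope.

Definition tree_discrepancy (r : nat) (f : {ffun edge -> 'I_r})
    (T : {set edge}) : rat :=
  r%:R * ((\max_(i < r) #|[set e in T | f e == i]|)%N%:R
          - (#|G|%:R - 1) / r%:R).

(* The extended values are only conventions for a maximum or minimum over an
   empty set: the result is finite when G is connected and 0 < r. *)
Definition discrepancy (r : nat) : \bar rat :=
  \big[Order.min/+oo%E]_(f : {ffun edge -> 'I_r})
    \big[Order.max/-oo%E]_(T in spanning_trees) (tree_discrepancy f T)%:E.

End Edges.

Section Separation.

Variables (r : nat) (G : sgraph).

(* A partition V_1, ..., V_r, S of the vertices into possibly empty parts is a
   labelling p, where p x = Some i means x \in V_i and p x = None means
   x \in S. *)
Definition balanced_separation (p : {ffun G -> option 'I_r}) : bool :=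
  [forall i : 'I_r, forall j : 'I_r,
     #|[set x | p x == Some i]| == #|[set x | p x == Some j]|] &&
  [forall i : 'I_r, forall j : 'I_r, (i < j) ==>
     [forall x : G, forall y : G,
        (p x == Some i) ==> (p y == Some j) ==> ~~ adj G x y]].

Definition has_separator (s : nat) : bool :=
  [exists p : {ffun G -> option 'I_r},
     balanced_separation p && (#|[set x | p x == None]| == s)].

Fact has_separator_ex : exists s, has_separator s.
Proof.
exists #|[set x | [ffun _ : G => None : option 'I_r] x == None]|.
apply/existsP; exists [ffun _ => None]; rewrite eqxx andbT.
apply/andP; split; apply/forallP => i; apply/forallP => j.
  by apply/eqP/eq_card => x; rewrite !inE ffunE.
by apply/implyP => _; apply/forallP => x; apply/forallP => y; rewrite ffunE.
Qed.

Definition separation_number : nat := ex_minn has_separator_ex.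

End Separation.

(* Main.v *)
(** Fix [t] and write k = t(t+1). Arrange cliques in a cycle, consecutive ones
    sharing a vertex, and colour all edges of a clique alike. A clique on w+1
    vertices carries at most w edges of a tree, so if the values w of the cliques
    of each colour add up to k, a spanning tree has at most k edges of each colour;
    as n = rk, the discrepancy is at most 1.

    Take colour 0 with t+1 cliques of weight w = t, alternating along the cycle
    with t cliques of weight t+1 of colour 1, and one clique of weight k for every
    other colour. If a balanced separation has a separator of size s much smaller
    than t, each clique lies essentially in one part, and each part has total
    weight within s of k. Modulo t, the weight of a part is its number of cliques of
    colour 1, so this number is at most s or at least t - s. Hence some part
    contains t - s of them, which leaves room for at most s cliques of colour 0,
    and the separator contains nearly all vertices shared by neighbouring cliques of
    colours 0 and 1. So s is of order t, that is of order the square root of n. *)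

Require Import Defs.
From HB Require Import structures.
From mathcomp Require Import all_boot all_order all_algebra.
From mathcomp Require Import reals constructive_ereal.
From mathcomp Require Import zify ring.

Set Implicit Arguments.
Unset Strict Implicit.
Unset Printing Implicit Defensive.

Import Order.TTheory GRing.Theory Num.Theory.
Local Open Scope ring_scope.

(** * Edges of spanning trees *)

Lemma edgeP (G : sgraph) (e : edge G) :
  exists xy : G * G, adj G xy.1 xy.2 && (val e == [set xy.1; xy.2]).
Proof.
have := valP e; rewrite inE => /existsP[x /existsP[y h]].
by exists (x, y).
Qed.

Lemma spanning_adjP (G : sgraph) (A : {set edge G}) (e : edge G) (x y : G) :
  e \in A -> val e = [set x; y] -> spanning_adj A x y.
Proof. by move=> eA hxy; apply/existsP; exists e; rewrite eA hxy eqxx. Qed.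

(** A simple path from [y] to [x] avoiding [e] would close up with [e] to a cycle of [T]. Acyclicity
    only excludes cycles on three or more vertices, so shorter paths are treated apart. *)
Lemma tree_edge_cut (G : sgraph) (T : {set edge G}) (e : edge G) (x y : G) :
  T \in spanning_trees G -> e \in T -> val e = [set x; y] -> x != y ->
  ~~ connect (spanning_adj (T :\ e)) y x.
Proof.
rewrite inE => /andP[_ /forallP acT] eT exy xy.
apply/negP => /connectP[p0 hp0]; case: (shortenP hp0) => p hp up _ {p0 hp0} xE.
have sz : (#|(y :: p)| <= #|G|)%N by apply: max_card.
rewrite (card_uniqP up) in sz.
have /forallP/(_ (in_tuple (y :: p)))/implyP := acT (Ordinal (sz : (size (y :: p) < #|G|.+1)%N)).
have subT : subrel (spanning_adj (T :\ e)) (spanning_adj T).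
  move=> u v /existsP[e' /andP[/setD1P[_ e'T] e'uv]].
  by apply/existsP; exists e'; rewrite e'T.
case: p hp up xE sz => [|z [|z' p]] hp up xE sz.
- by rewrite xE eqxx in xy.
- rewrite /= in xE; move: hp; rewrite /= andbT -xE.
  move=> /existsP[e' /andP[/setD1P[/eqP ne _] /eqP e'E]].
  by case: ne; apply: val_inj; rewrite e'E exy setUC.
- move/(_ isT)/negP; apply; apply/andP; split=> //.
  change (path (spanning_adj T) y (rcons [:: z, z' & p] y)).
  rewrite rcons_path (sub_path subT hp) -xE.
  exact: spanning_adjP eT exy.
Qed.

(* If every edge of [A] lies in a star-shaped cluster made of a centre [c] and of
   vertices [u] of [D] with [z u = c], then the edge vectors of [A] are spanned
   by the vectors [u - z u], [u \in D]; the indicators of the components of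
   [T :\ e] form a dual family, so the edge vectors are independent. *)
Lemma tree_edges_le_card (G : sgraph) (T A : {set edge G}) (D : {set G})
    (z : G -> G) :
  T \in spanning_trees G -> A \subset T ->
  (forall e, e \in A -> exists c, forall u, u \in val e ->
     (u == c) || (u \in D) && (z u == c)) ->
  (#|A| <= #|D|)%N.
Proof.
move=> hT AT hA.
have [ends endsP] := fin_all_exists (@edgeP G).
have [ctr ctrP] : exists ctr : edge G -> G, forall e, e \in A ->
    forall u, u \in val e -> (u == ctr e) || (u \in D) && (z u == ctr e).
  apply: (fin_all_exists (P := fun e c => e \in A -> forall u, u \in val e ->
     (u == c) || (u \in D) && (z u == c))) => e.
  have [eA|neA] := boolP (e \in A); last by exists (ends e).1.
  by have [c hc] := hA e eA; exists c.
pose x e := (ends e).1; pose y e := (ends e).2.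
have exy e : val e = [set x e; y e] by have /andP[_ /eqP] := endsP e.
have nxy e : x e != y e.
  apply/eqP => h; have /andP[] := endsP e.
  by rewrite -/(x e) -/(y e) h adj_irr.
pose phi e u : rat := (connect (spanning_adj (T :\ e)) (y e) u)%:R.
have phi_diag e : e \in T -> phi e (y e) - phi e (x e) = 1.
  move=> eT; rewrite /phi connect0.
  by rewrite (negbTE (tree_edge_cut hT eT (exy e) (nxy e))) subr0.
have phi_off e e' : e' \in T -> e != e' -> phi e (y e') - phi e (x e') = 0.
  move=> e'T ne; apply/eqP; rewrite subr_eq0 /phi; apply/eqP; congr (_%:R).
  have cs : connect_sym (spanning_adj (T :\ e)).
    by apply: sym_connect_sym; apply: spanning_sym.
  rewrite ![connect _ (y e) _]cs; congr (nat_of_bool _).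
  apply: (same_connect cs); apply: connect1; rewrite spanning_sym.
  by apply: (spanning_adjP _ (exy e')); rewrite !inE eq_sym ne.
(* Coordinates of the edge vector [y e - x e] in the vectors [u - z u], obtained by passing through
   the centre [ctr e]. *)
pose q e u : rat :=
  ((z u == ctr e) && (u == y e))%:R - ((z u == ctr e) && (u == x e))%:R.
have qE (f : G -> rat) e v : e \in A -> v \in val e ->
    \sum_(u in D) (f u - f (z u)) * ((z u == ctr e) && (u == v))%:R
    = f v - f (ctr e).
  move=> eA ve; case: (boolP ((v \in D) && (z v == ctr e))) => [/andP[vD /eqP zv]|].
    rewrite (bigD1 v) //= zv !eqxx mulr1 big1 ?addr0 // => u /andP[_ /negbTE ->].
    by rewrite andbF mulr0.
  move=> nv; have := ctrP e eA v ve; rewrite (negbTE nv) orbF => h.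
  rewrite (eqP h).
  rewrite subrr big1 // => u uD; case: eqP => [zu|]; last by rewrite mulr0.
  case: eqP => [uc|]; last by rewrite mulr0.
  by rewrite zu uc subrr mul0r.
pose P : 'M[rat]_(#|A|, #|D|) :=
  \matrix_(i, j) (phi (enum_val i) (enum_val j) - phi (enum_val i) (z (enum_val j))).
pose Q : 'M[rat]_(#|D|, #|A|) := \matrix_(j, i) q (enum_val i) (enum_val j).
have PQ : P *m Q = 1%:M.
  apply/matrixP => i i'; rewrite !mxE.
  under eq_bigr => j _ do rewrite !mxE.
  set e := enum_val i; set e' := enum_val i'.
  have e'A : e' \in A by apply: enum_valP.
  rewrite -(big_enum_val (fun u => (phi e u - phi e (z u)) * q e' u)) /=.
  under eq_bigr => u _ do rewrite /q mulrBr.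
  rewrite sumrB !qE // ?exy ?set21 ?set22 // opprB addrA subrK.
  have e'T := subsetP AT _ e'A.
  case: (eqVneq i i') => [ii|nii].
    by rewrite /e ii phi_diag.
  by rewrite phi_off // (inj_eq enum_val_inj).
by rewrite -(mxrank1 rat #|A|) -PQ (leq_trans (mxrankM_maxl _ _)) ?rank_leq_col.
Qed.

(** * Graphs glued from cliques *)

Section BlobGraph.

Variables (V I : finType) (b : V -> I) (s : I -> V).

(* The cliques of the graph: the fibre of [b] over [B], together with [s B]. In a
   ring, [s B] is the vertex that [B] shares with the next clique. *)
Definition in_blob (B : I) : pred V := fun x => (b x == B) || (x == s B).

Definition blob_adj : rel V :=
  fun x y => (x != y) && [exists B, in_blob B x && in_blob B y].

Fact blob_adj_sym : symmetric blob_adj.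
Proof.
move=> x y; rewrite /blob_adj eq_sym; congr (_ && _).
by apply: eq_existsb => B; rewrite andbC.
Qed.

Fact blob_adj_irr : irreflexive blob_adj.
Proof. by move=> x; rewrite /blob_adj eqxx. Qed.

Definition blob_graph : sgraph := SGraph blob_adj_sym blob_adj_irr.

Lemma in_blob_adj B x y :
  in_blob B x -> in_blob B y -> x != y -> adj blob_graph x y.
Proof.
by move=> hx hy xy; rewrite /= /blob_adj xy; apply/existsP; exists B; rewrite hx.
Qed.

Lemma blob_edge (e : edge blob_graph) : exists B, forall x, x \in val e -> in_blob B x.
Proof.
have [xy /andP[/andP[_ /existsP[B /andP[hx hy]]] /eqP ->]] := edgeP e.
by exists B => x /set2P[] ->.
Qed.

Lemma blob_discrepancy_le1 (r k : nat) (c : I -> 'I_r) : (0 < r)%N ->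
  (forall i, #|[set x | c (b x) == i]| = k) -> (discrepancy blob_graph r <= 1)%E.
Proof.
move=> r0 hk; have [B hB] := fin_all_exists blob_edge.
have cardV : #|V| = (r * k)%N.
  rewrite -sum1_card (partition_big (fun x => c (b x)) xpredT) //=.
  under eq_bigr => i _ do rewrite sum1dep_card hk.
  by rewrite sum_nat_const card_ord.
pose f : {ffun edge blob_graph -> 'I_r} := [ffun e => c (B e)].
apply: le_trans (bigmin_le _ f _) _.
apply: bigmax_le => [|T hT]; first by rewrite leNye.
rewrite lee_fin /tree_discrepancy.
have hmax : (\max_(i < r) #|[set e in T | f e == i]| <= k)%N.
  apply/bigmax_leqP => i _; rewrite -(hk i).
  (* The clusters are the cliques, with centres [s B]; [D] is the colour class of [i], of size
     [k]. *)
  apply: (tree_edges_le_card (z := fun x : blob_graph => s (b x)) hT).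
    by apply/subsetP => e; rewrite inE => /andP[].
  move=> e; rewrite inE ffunE => /andP[_ /eqP ei].
  exists (s (B e)) => u /(hB e) /orP[/eqP bu|->] //.
  by rewrite inE bu ei !eqxx orbT.
have r0' : (r%:R : rat) != 0 by rewrite pnatr_eq0 -lt0n.
(* As n = rk, the discrepancy is r times the maximum, minus rk, plus 1. *)
rewrite mulrBr [X in _ - X]mulrC divfK // cardV natrM opprB addrCA gerDl subr_le0.
by rewrite -!natrM ler_nat leq_mul2l hmax orbT.
Qed.

End BlobGraph.

(** * Connectivity of a ring of cliques *)

Section BlobRing.

Variables (V : finType) (m : nat) (b : V -> 'I_m.+2) (s : 'I_m.+2 -> V).
Hypothesis bs : forall B, b (s B) = ordS B.

Let G := blob_graph b s.

Lemma blob_centre_inj : injective s.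
Proof. by move=> B B' /(congr1 b); rewrite !bs => /ordS_inj. Qed.

Lemma ordS_neq (B : 'I_m.+2) : ordS B != B.
Proof.
rewrite -val_eqE /=; have := ltn_ord B; rewrite leq_eqVlt => /orP[/eqP[->]|h].
  by rewrite modnn.
by rewrite modn_small // eqn_leq ltnn.
Qed.

(** The shared vertices lie on a closed walk that one deletion does not disconnect, and every vertex
    lies in a clique containing two of them. *)
Lemma blob_ring_2connected : (2 < #|V|)%N -> vertex_connected 2 G.
Proof.
move=> V2; rewrite /vertex_connected V2; apply/forallP => S; apply/implyP => S2.
pose C := ~: S.
have S1 x y : x \in S -> y \in S -> x = y.
  by move=> xS yS; have /card_le1_eqP h : (#|S| <= 1)%N := S2; apply: h.
(* Vacuous if [x] or [y] is deleted, hence the membership condition in [Rtrans]. *)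
pose R (x y : G) := forall (hx : x \in C) (hy : y \in C),
  connect (adj (induced C)) (exist _ x hx) (exist _ y hy).
have Rsym x y : R x y -> R y x.
  move=> h hx hy; rewrite (sym_connect_sym (@adj_sym (induced C))); exact: h.
have Rtrans y x z : y \in C -> R x y -> R y z -> R x z.
  by move=> hy h1 h2 hx hz; apply: connect_trans (h1 hx hy) (h2 hy hz).
have Rblob B x y : in_blob b s B x -> in_blob b s B y -> R x y.
  move=> hx hy xC yC; have [xy|xy] := eqVneq x y.
    by subst y; rewrite (bool_irrelevance xC yC) connect0.
  by apply: connect1; apply: (in_blob_adj hx hy xy).
pose c l := s (inord l).
have cS l : (l.+1 < m.+2)%N -> R (c l) (c l.+1).
  move=> hl; apply: (Rblob (inord l.+1)); last by rewrite /in_blob eqxx orbT.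
  rewrite /in_blob bs; apply/orP; left; rewrite -val_eqE /= !inordK ?modn_small //.
  exact: ltnW.
have cW : R (c m.+1) (c 0%N).
  apply: (Rblob (inord 0)); last by rewrite /in_blob eqxx orbT.
  rewrite /in_blob bs; apply/orP; left; rewrite -val_eqE /= !inordK ?modnn //.
have cpath i j : (i <= j < m.+2)%N -> (forall l, (i <= l <= j)%N -> c l \in C) ->
    R (c i) (c j).
  elim: j => [|j IH] /andP[ij jm] hC.
    by move: ij; rewrite leqn0 => /eqP ->; apply: (Rblob (inord 0)); rewrite /in_blob eqxx orbT.
  move: ij; rewrite leq_eqVlt => /orP[/eqP ->|ij].
    by apply: (Rblob (inord j.+1)); rewrite /in_blob eqxx orbT.
  apply: (Rtrans (c j)); first by rewrite hC // -ltnS ij /=.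
    apply: IH; first by rewrite -ltnS ij ltnW.
    by move=> l /andP[il lj]; rewrite hC // il ltnW.
  exact: cS.
have cc_le i j : (i <= j < m.+2)%N -> c i \in C -> c j \in C -> R (c i) (c j).
  move=> /andP[ij jm] iC jC.
  have [/forallP h|] := boolP [forall l : 'I_m.+2, (i <= l <= j)%N ==> (c l \in C)].
    apply: cpath; first by rewrite ij.
    move=> l /andP[il lj]; have := h (Ordinal (leq_ltn_trans lj jm)).
    by rewrite /= il lj.
  (* The deleted vertex is [c l], between the two, so the other way round, through [c m.+1] and
     [c 0], is free. *)
  rewrite negb_forall => /existsP[l]; rewrite negb_imply => /andP[/andP[il lj] lS].
  have others l' : (l' < m.+2)%N -> l' != l -> c l' \in C.
    move=> l'm l'l; rewrite inE; apply: contra l'l => l'S.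
    rewrite inE negbK in lS; have /blob_centre_inj/(congr1 val) := S1 _ _ l'S lS.
    by rewrite /= !inordK // => ->.
  have il' : (i < l)%N.
    rewrite ltn_neqAle il andbT; apply: contraNneq lS => <-; exact: iC.
  have lj' : (l < j)%N.
    rewrite ltn_neqAle lj andbT; apply: contraNneq lS => ->; exact: jC.
  apply: Rsym; apply: (Rtrans (c m.+1)).
  - by rewrite others // neq_ltn (leq_trans lj') ?orbT.
  - apply: cpath; first by rewrite ltnS -ltnS jm leqnn.
    move=> l' /andP[jl' l'm]; rewrite others // neq_ltn.
    by rewrite (leq_trans lj') ?orbT.
  - apply: (Rtrans (c 0%N)) => //.
      by rewrite others // neq_ltn (leq_ltn_trans _ il').
    apply: cpath; first by rewrite (leq_ltn_trans ij jm).
    move=> l' /andP[_ l'i]; rewrite others ?(leq_ltn_trans (leq_trans l'i ij) jm) //.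
    by rewrite neq_ltn (leq_ltn_trans l'i il').
have ss B B' : s B \in C -> s B' \in C -> R (s B) (s B').
  rewrite -(inord_val B) -(inord_val B') -/(c B) -/(c B') => hB hB'.
  have [h|/ltnW h] := leqP B B'.
    by apply: cc_le => //; rewrite h ltn_ord.
  by apply: Rsym; apply: cc_le => //; rewrite h ltn_ord.
have toc x : x \in C -> exists2 B, s B \in C & R x (s B).
  move=> xC; have [h|h] := boolP (s (b x) \in C).
    by exists (b x) => //; apply: (Rblob (b x)); rewrite /in_blob eqxx ?orbT.
  (* The preceding shared vertex also lies in the clique of [x], and differs from the deleted
     [s (b x)]. *)
  exists (ord_pred (b x)).
    rewrite inE; apply/negP => h'; rewrite inE negbK in h.
    have /blob_centre_inj hE := S1 _ _ h h'.
    by have := ordS_neq (b x); rewrite {1}hE ord_predK eqxx.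
  by apply: (Rblob (b x)); rewrite /in_blob ?bs ?ord_predK eqxx.
apply/andP; split.
  rewrite card_sig (eq_card (B := mem C)) // cardsCs setCK subn_gt0.
  by apply: leq_trans S2 (ltnW _).
apply/forallP => -[x xC]; apply/forallP => -[y yC].
have [B BC xB] := toc x xC; have [B' BC' yB'] := toc y yC.
suff: R x y by apply.
apply: (Rtrans (s B)) => //; apply: (Rtrans (s B')) => //; first exact: ss.
exact: Rsym.
Qed.

End BlobRing.

(** * Weighted rings and their balanced separations *)

Definition weight (t l : nat) : nat :=
  if (l <= t.*2)%N then (t + odd l)%N else (t * t.+1)%N.

Lemma sum_pairs (F : nat -> nat) t :
  (\sum_(l < t.*2) F l = \sum_(l < t) (F l.*2 + F l.*2.+1))%N.
Proof.
elim: t => [|t IH]; first by rewrite !big_ord0.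
by rewrite doubleS !big_ord_recr /= IH addnA.
Qed.

Section WeightedRing.

Variables (V : finType) (m r' t : nat) (b : V -> 'I_m.+2) (s : 'I_m.+2 -> V).
Hypothesis bs : forall B, b (s B) = ordS B.
Hypothesis hm : m.+2 = (t.*2.+1 + r')%N.
Hypothesis hw : forall B, #|[set x | b x == B]| = weight t B.

Let G := blob_graph b s.

(** Any grouping [g] is allowed, to serve both the colouring and a separation. The form shows that
    modulo [t] the size is the number of odd positions below [t.*2] in the class. *)
Lemma card_blob_fiber (r : nat) (g : 'I_m.+2 -> 'I_r) (i : 'I_r) :
  let d l := (g (inord l) == i) : nat in
  #|[set x | g (b x) == i]| =
    (t * (\sum_(l < t) d l.*2 + \sum_(l < t) d l.*2.+1 + d t.*2
          + t.+1 * \sum_(l < r') d (t.*2.+1 + l))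
     + \sum_(l < t) d l.*2.+1)%N.
Proof.
move=> d.
have -> : #|[set x | g (b x) == i]| = (\sum_(l < m.+2) d l * weight t l)%N.
  rewrite -sum1dep_card (partition_big b (fun B => g B == i)) //=.
  rewrite big_mkcond /=; apply: eq_bigr => B _; rewrite /d inord_val.
  case: (eqVneq (g B) i) => [gB|//]; rewrite mul1n -hw -sum1dep_card.
  by apply: eq_bigl => x; case: (eqVneq (b x) B) => [->|]; rewrite ?gB ?eqxx ?andbF.
rewrite -(big_mkord xpredT (fun l => d l * weight t l)%N) hm big_mkord.
rewrite big_split_ord /= big_ord_recr /= (sum_pairs (fun l => d l * weight t l)%N).
have -> : (\sum_(l < t) (d l.*2 * weight t l.*2 + d l.*2.+1 * weight t l.*2.+1) =
  t * \sum_(l < t) d l.*2 + t.+1 * \sum_(l < t) d l.*2.+1)%N.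
  rewrite big_split /= !big_distrr /=; congr (_ + _)%N; apply: eq_bigr => l _.
    by rewrite /weight leq_double ltnW ?ltn_ord // odd_double addn0 mulnC.
  by rewrite /weight ltn_double ltn_ord /= odd_double addn1 mulnC.
have -> : (\sum_(l < r') d (t.*2.+1 + l) * weight t (t.*2.+1 + l) =
  t * t.+1 * \sum_(l < r') d (t.*2.+1 + l))%N.
  rewrite big_distrr /=; apply: eq_bigr => l _.
  by rewrite /weight leqNgt ltnS leq_addr mulnC.
rewrite /weight leqnn odd_double addn0.
ring.
Qed.

Definition blob_colour (B : 'I_m.+2) : 'I_r'.+2 :=
  inord (if (B <= t.*2)%N then odd B : nat else (B - t.*2).+1)%N.

Lemma card_blob_colour (i : 'I_r'.+2) :
  #|[set x | blob_colour (b x) == i]| = (t * t.+1)%N.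
Proof.
rewrite card_blob_fiber.
have hB l : (l < m.+2)%N ->
    (blob_colour (inord l) == i) =
    ((if (l <= t.*2)%N then odd l : nat else (l - t.*2).+1) == i :> nat).
  move=> lm; rewrite -val_eqE /= !inordK //; case: ifP => // h.
    by case: (odd _).
  by lia.
have e0 : (\sum_(l < t) (blob_colour (inord l.*2) == i) = t * (i == 0 :> nat))%N.
  rewrite -[t in RHS]card_ord -sum_nat_const; apply: eq_bigr => l _.
  have lt := ltn_ord l; rewrite hB; last by lia.
  by rewrite ifT ?odd_double 1?eq_sym //; lia.
have e1 : (\sum_(l < t) (blob_colour (inord l.*2.+1) == i) = t * (i == 1 :> nat))%N.
  rewrite -[t in RHS]card_ord -sum_nat_const; apply: eq_bigr => l _.
  have lt := ltn_ord l; rewrite hB; last by lia.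
  by rewrite ifT /= ?odd_double 1?eq_sym //; lia.
have e2 : (blob_colour (inord t.*2) == i) = (i == 0 :> nat).
  by rewrite hB ?leqnn ?odd_double 1?eq_sym //; lia.
have e3 : (\sum_(l < r') (blob_colour (inord (t.*2.+1 + l)) == i) = (1 < i))%N.
  under eq_bigr => l _.
    rewrite hB; last by have := ltn_ord l; lia.
    rewrite ifF; last by lia.
    rewrite (_ : (_ - _).+1 = l.+2); last by lia.
    over.
  have [i1|i1] := leqP i 1.
    by rewrite big1 // => l _; apply/eqP; rewrite eqb0; lia.
  have hi : (i - 2 < r')%N by have := ltn_ord i; lia.
  rewrite (bigD1 (Ordinal hi)) //= big1 ?addn0.
    by apply/eqP; rewrite eqb1; lia.
  by move=> l; rewrite -val_eqE /= => h; apply/eqP; rewrite eqb0; lia.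
rewrite /= e0 e1 e2 e3.
case: (val i) => [|[|j]] /=; lia.
Qed.

Lemma card_weighted_ring : #|V| = (r'.+2 * (t * t.+1))%N.
Proof.
rewrite -sum1_card (partition_big (fun x => blob_colour (b x)) xpredT) //=.
under eq_bigr => i _ do rewrite sum1dep_card card_blob_colour.
by rewrite sum_nat_const card_ord.
Qed.

Lemma separator_large (sz : nat) :
  has_separator r'.+2 G sz -> (t <= r'.+3 * sz)%N.
Proof.
move=> /existsP[p /andP[/andP[/forallP bal /forallP sep] /eqP hsz]].
(* With r = [r'.+2], the factor r + 1 is at least r, for the pigeonhole step, and at least 3, for
   the final count. *)
rewrite leqNgt; apply/negP => small.
have sepE x y i j : adj G x y -> p x = Some i -> p y = Some j -> i = j.
  move=> xy px py; apply/eqP; apply: contraT => ij.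
  wlog lt_ij : x y i j xy px py ij / (i < j)%N.
    move=> IH; case: (ltngtP i j) => h; first exact: (IH x y i j).
      by apply: (IH y x j i) => //; rewrite 1?adj_sym 1?eq_sym.
    by move: ij; rewrite -val_eqE /= h eqxx.
  have /forallP/(_ j)/implyP/(_ lt_ij)/forallP/(_ x)/forallP/(_ y) := sep i.
  by rewrite px py !eqxx xy.
(* Every fibre has at least [t > sz] vertices, so one avoids the separator; its part becomes that of
   the clique. *)
have [beta betaP] : exists beta : 'I_m.+2 -> 'I_r'.+2,
    forall B, exists2 x, b x = B & p x = Some (beta B).
  apply: (fin_all_exists (P := fun B i => exists2 x, b x = B & p x = Some i)) => B.
  have : ~~ ([set x | b x == B] \subset [set x | p x == None]).
    apply/negP => /subset_leq_card; rewrite hw hsz /weight; case: ifP => _; nia.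
  case/subsetPn => x; rewrite !inE => /eqP bx; case px: (p x) => [i|//] _.
  by exists i, x.
have blobE B x : in_blob b s B x -> p x != None -> p x = Some (beta B).
  case px: (p x) => [i|//] hx _; have [y yB py] := betaP B.
  have [xy|xy] := eqVneq x y; first by rewrite -px xy py.
  congr Some; apply: (sepE x y) => //; apply: (in_blob_adj hx _ xy).
  by rewrite /in_blob yB eqxx.
pose v := #|[set x | p x == Some ord0]|.
have vE i : #|[set x | p x == Some i]| = v.
  by apply/eqP; have /forallP := bal i; apply.
have hn : (r'.+2 * v + sz = r'.+2 * (t * t.+1))%N.
  rewrite -card_weighted_ring -sum1_card (bigID (fun x => p x == None)) /= addnC.
  rewrite sum1dep_card hsz; congr (_ + _)%N.
  rewrite (partition_big (fun x => odflt ord0 (p x)) xpredT) //=.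
  rewrite -[r'.+2 in LHS]card_ord -sum_nat_const; apply: eq_bigr => i _.
  by rewrite -(vE i) -sum1dep_card; apply: eq_bigl => x; case: (p x).
pose W i := #|[set x | beta (b x) == i]|.
have in_own x : in_blob b s (b x) x by rewrite /in_blob eqxx.
have Wlo i : (v <= W i)%N.
  rewrite -(vE i); apply: subset_leq_card; apply/subsetP => x; rewrite !inE => /eqP px.
  have := blobE _ _ (in_own x); rewrite px => /(_ isT) [->]; exact: eqxx.
have Whi i : (W i <= v + sz)%N.
  rewrite -(vE i) -hsz; apply: leq_trans (leq_card_setU _ _).
  apply: subset_leq_card; apply/subsetP => x; rewrite !inE => /eqP <-.
  by case: (boolP (p x == None)) => [|h]; rewrite ?orbT // (blobE (b x)) ?eqxx.
pose d i l := (beta (inord l) == i) : nat.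
pose J i := (\sum_(l < t) d i l.*2.+1)%N.
have Jsum : (\sum_i J i = t)%N.
  rewrite exchange_big /= -[RHS]muln1 -[t in RHS]card_ord -sum_nat_const.
  apply: eq_bigr => l _; rewrite (bigD1 (beta (inord l.*2.+1))) //= /d eqxx.
  by rewrite big1 // => i /negbTE; rewrite eq_sym => ->.
(* Pigeonhole: the [J i] sum to [t], which exceeds r times [sz]. *)
have [i Ji] : exists i, (sz < J i)%N.
  apply/existsP; apply: contraT; rewrite negb_exists => /forallP h.
  have : (\sum_i J i <= \sum_(i < r'.+2) sz)%N.
    by apply: leq_sum => i _; rewrite leqNgt.
  by rewrite Jsum sum_nat_const card_ord; nia.
have Jt : (J i <= t)%N by rewrite -Jsum (bigD1 i) //= leq_addr.
pose Bl := (\sum_(l < t) d i l.*2)%N.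
have [U WU UJ] : exists2 U, W i = (t * U + J i)%N & (Bl + J i <= U)%N.
  rewrite /W card_blob_fiber -/(d i) -/(J i) -/Bl; eexists; first by [].
  by rewrite -addnA leq_addr.
(* [W i] is within [sz] of [t * t.+1]. A larger [U] overshoots because [sz < J i], a smaller one
   falls short because [J i <= t]. *)
have Ut : U = t.
  have := Wlo i; have := Whi i; rewrite WU.
  have : (t * t.+1 <= v + sz)%N by nia.
  have : (v <= t * t.+1)%N by nia.
  move=> h1 h2 h3 h4; case: (ltngtP U t) => // h; nia.
have : (t <= J i + sz)%N.
  have := Wlo i; rewrite WU Ut; have : (t * t.+1 <= v + sz)%N by nia.
  nia.
move=> tJ.
(* If clique 2l+1 belongs to part [i] but clique 2l does not, their shared vertex is in the
   separator. *)
have JBl : (J i <= Bl + sz)%N.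
  rewrite -hsz.
  have : (J i <= Bl + \sum_(l < t) (p (s (inord l.*2)) == None))%N.
    rewrite -big_split /=; apply: leq_sum => l _; rewrite /d.
    case: eqP => //= h1; case: eqP => //= h2.
    case: (boolP (p _ == None)) => //= h3; case: h2.
    have lt := ltn_ord l.
    have e1 : in_blob b s (inord l.*2) (s (inord l.*2)) by rewrite /in_blob eqxx orbT.
    have e2 : in_blob b s (inord l.*2.+1) (s (inord l.*2)).
      rewrite /in_blob bs -val_eqE /= !inordK ?modn_small ?eqxx //; lia.
    by have := blobE _ _ e1 h3; rewrite (blobE _ _ e2 h3) h1 => -[].
  move=> h; apply: leq_trans h _; rewrite leq_add2l.
  rewrite -(big_mkcond (fun l : 'I_t => p (s (inord l.*2)) == None) (fun=> 1%N)).
  rewrite sum1dep_card.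
  have inj : injective (fun l : 'I_t => s (inord l.*2)).
    move=> l l' /(blob_centre_inj bs)/(congr1 val) /=.
    have := ltn_ord l; have := ltn_ord l' => h1 h2.
    rewrite !inordK; try lia.
    by move/double_inj/val_inj.
  rewrite -(card_imset _ inj); apply: subset_leq_card.
  by apply/subsetP => x /imsetP[l]; rewrite !inE => h1 ->.
(* [Bl <= t - J i <= sz], so [J i <= 2 * sz] and [t <= 3 * sz], against [small]. *)
nia.
Qed.

End WeightedRing.

(** * Existence of the rings and choice of constants *)

Lemma weighted_blobs_exist (m : nat) (w : 'I_m.+2 -> nat) :
  (forall B, 0 < w B)%N ->
  exists (V : finType) (b : V -> 'I_m.+2) (s : 'I_m.+2 -> V),
    (forall B, b (s B) = ordS B) /\ (forall B, #|[set x | b x == B]| = w B).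
Proof.
move=> w0; pose F (B : 'I_m.+2) := 'I_(w B).
exists {B : 'I_m.+2 & F B}, tag, (fun B => Tagged F (Ordinal (w0 (ordS B)))).
split=> // B.
have injT : injective (@Tagged _ B F) by move=> x y /eqP; rewrite eq_Tagged => /eqP.
rewrite -[RHS]card_ord -(card_imset _ injT).
apply: eq_card => -[B' x]; rewrite inE /=; apply/eqP/imsetP => [E|[y _ E]].
  by case: B / E {injT}; exists x.
exact: (congr1 (@tag _ F) E).
Qed.

Theorem proposition1p2 (R : realType) (r : nat) (hr : (2 <= r)%N) :
  exists2 c : R, 0 < c &
    forall N : nat, exists n : nat, (N <= n)%N /\
      exists G : sgraph,
        [/\ #|G| = n,
            vertex_connected 2 G,
            c * Num.sqrt n%:R <= (separation_number r G)%:R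
          & (discrepancy G r <= 1)%E].
Proof.
case: r hr => [|[|r']] // _.
(* n = rt(t+1) is at most the square of 2rt, and t is at most r + 1 times the separation number. *)
pose a : nat := (r'.+2.*2 * r'.+3)%N.
exists a%:R^-1; first by rewrite invr_gt0 ltr0n.
move=> N; pose t := N.+1.
pose m := (N.*2.+1 + r')%N.
have hm : m.+2 = (t.*2.+1 + r')%N by rewrite /m /t; lia.
have w0 (B : 'I_m.+2) : (0 < weight t B)%N by rewrite /weight; case: ifP.
have [V [b [s [bs hw]]]] := weighted_blobs_exist w0.
have cV := card_weighted_ring hm hw.
exists (r'.+2 * (t * t.+1))%N; split; first by rewrite /t; nia.
exists (blob_graph b s); split=> //.
- by apply: blob_ring_2connected => //; rewrite cV /t; nia.
- rewrite /separation_number; case: ex_minnP => sz hsz _.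
  have tsz := separator_large bs hm hw hsz.
  rewrite ler_pdivrMl ?ltr0n // -natrM.
  rewrite -[leRHS]ger0_norm ?ler0n // -sqrtr_sqr ler_wsqrtr // -natrX ler_nat.
  have : (r'.+2 * (t * t.+1) <= (r'.+2.*2 * t) ^ 2)%N by rewrite /t; nia.
  move=> h; apply: leq_trans h _; rewrite leq_exp2r // /a; nia.
- exact: (blob_discrepancy_le1 (c := @blob_colour m r' t) s isT (card_blob_colour hm hw)).
Qed.
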